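(* Let $X$ be a nonempty set and let $F\colon X^*\to X^*$ be a function. (a) If $F$ is associative and weakly length-based, then there is a map $\alpha\colon\mathbb{N}\to\mathbb{N}$ such that $F(X^k)\subseteq X^{\alpha(k)}$ for all $k\in\mathbb{N}$ and $$\alpha(n+k)=\alpha(\alpha(n)+k)\qquad\text{for all } n,k\in\mathbb{N}.$$ In this case, $F$ is standard if and only if $\alpha$ satisfies: for all $n\in\mathbb{N}$, $\alpha(n)=0$ if and only if $n=0$. (b) $F$ is associative and length-based if and only if there exist a map $\psi\colon\mathbb{N}\to X^*$ satisfying $|\psi(n)|=n$ for all $n\in\mathbb{N}$ and a map $\alpha\colon\mathbb{N}\to\mathbb{N}$ satisfying $\alpha(n+k)=\alpha(\alpha(n)+k)$ for all $n,k\in\mathbb{N}$ such that $F(\mathbf{x})=\psi(\alpha(|\mathbf{x}|))$ for all $\mathbf{x}\in X^*$.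
   Context: $X^*=\bigcup_{n\geq 0}X^n$ is the free monoid of strings over $X$ (concatenation written as juxtaposition), with empty string $\varepsilon$, and $|\mathbf{x}|$ is the length of a string. $\mathbb{N}$ is the set of nonnegative integers. $F\colon X^*\to X^*$ is associative if $F(\mathbf{x}\mathbf{y}\mathbf{z})=F(\mathbf{x}F(\mathbf{y})\mathbf{z})$ for all $\mathbf{x},\mathbf{y},\mathbf{z}\in X^*$. $F$ is standard if, for all $\mathbf{x}$, $F(\mathbf{x})=F(\varepsilon)$ if and only if $\mathbf{x}=\varepsilon$. $F$ is weakly length-based if $|F(\mathbf{x})|=|F(\mathbf{y})|$ whenever $|\mathbf{x}|=|\mathbf{y}|$. $F$ is length-based if $F(\mathbf{x})=F(\mathbf{y})$ whenever $|\mathbf{x}|=|\mathbf{y}|$. *)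

(* Defs.v *)
From mathcomp Require Import all_boot.

Set Implicit Arguments.
Unset Strict Implicit.
Unset Printing Implicit Defensive.

Section StringFunctions.
Variable X : Type.
Implicit Types (F : seq X -> seq X) (x y z : seq X).

Definition associative_str F : Prop :=
  forall x y z, F (x ++ y ++ z) = F (x ++ F y ++ z).

Definition standard F : Prop :=
  forall x, F x = F [::] <-> x = [::].

Definition weakly_length_based F : Prop :=
  forall x y, size x = size y -> size (F x) = size (F y).

Definition length_based F : Prop :=
  forall x y, size x = size y -> F x = F y.

(* The image of X^k under F is contained in X^(alpha k), for every k. *)
Definition maps_lengths F (alpha : nat -> nat) : Prop :=
  forall (k : nat) x, size x = k -> size (F x) = alpha k.

End StringFunctions.

Definition length_equation (alpha : nat -> nat) : Prop :=
  forall n k : nat, alpha (n + k) = alpha (alpha n + k).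

(* Main.v *)
(** Only the case [x = [::]] of associativity, [F (y ++ z) = F (F y ++ z)],
    enters the forward directions; taking lengths gives the equation for
    [alpha], and [z = [::]] gives idempotence of [F].  In (b), if [n] is in the
    range of [alpha], then [psi n] is forced to be the common value of [F] on
    strings of length [n]; elsewhere any string of length [n] will do. *)
Require Import Defs.
From mathcomp Require Import all_boot.

Lemma associative_str_catl (X : Type) (F : seq X -> seq X) :
  associative_str F -> forall y z, F (y ++ z) = F (F y ++ z).
Proof. by move=> assoF y z; exact: (assoF [::] y z). Qed.

Lemma associative_str_idem (X : Type) (F : seq X -> seq X) :
  associative_str F -> forall x, F (F x) = F x.
Proof. by move=> /associative_str_catl/(_ _ [::]) + x => /(_ x); rewrite !cats0. Qed.

Lemma length_based_weakly (X : Type) (F : seq X -> seq X) :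
  length_based F -> weakly_length_based F.
Proof. by move=> lbF x y /lbF ->. Qed.

(** The letter [a] supplies one test string of each length, from which [alpha] is read off. *)
Lemma maps_lengths_nseq (X : Type) (a : X) (F : seq X -> seq X) :
  weakly_length_based F -> maps_lengths F (fun k => size (F (nseq k a))).
Proof. by move=> wlbF k x szx; apply: wlbF; rewrite size_nseq. Qed.

Lemma maps_lengths_equation (X : Type) (a : X) (F : seq X -> seq X) alpha :
  associative_str F -> maps_lengths F alpha -> length_equation alpha.
Proof.
move=> assoF Falpha n k.
rewrite -(Falpha (n + k) (nseq n a ++ nseq k a)); last first.
  by rewrite size_cat !size_nseq.
rewrite (associative_str_catl _ _ assoF); apply: (Falpha).
by rewrite size_cat (Falpha n) size_nseq.
Qed.

Lemma standardP (X : Type) (a : X) (F : seq X -> seq X) alpha :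
  associative_str F -> maps_lengths F alpha ->
  standard F <-> (forall n, alpha n = 0 <-> n = 0).
Proof.
move=> assoF Falpha; split=> [stF | alpha0].
  (* Idempotence reads [F (F [::]) = F [::]], so standardness applies to the string [F [::]]. *)
  have F0 : F [::] = [::].
    by apply/stF; exact: associative_str_idem.
  move=> n; split=> [an0 | ->]; last by rewrite -(Falpha 0 [::]) // F0.
  have /size0nil Fn0 : size (F (nseq n a)) = 0 by rewrite (Falpha n) ?size_nseq.
  have /stF/(congr1 size) : F (nseq n a) = F [::] by rewrite Fn0 F0.
  by rewrite size_nseq.
move=> x; split=> [Fx | -> //].
(* [alpha (size x)] is the length of [F x = F [::]], namely [alpha 0 = 0]. *)
apply/size0nil/alpha0; rewrite -(Falpha _ x) // Fx (Falpha 0) //.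
exact/alpha0.
Qed.

Lemma length_based_factor (X : Type) (a : X) (F : seq X -> seq X) alpha :
  associative_str F -> length_based F -> maps_lengths F alpha ->
  exists psi : nat -> seq X,
    (forall n, size (psi n) = n) /\ (forall x, F x = psi (alpha (size x))).
Proof.
move=> assoF lbF Falpha.
(* Idempotence of [F] makes [alpha] idempotent, so its range is its set of fixed points: the test
   [alpha n == n] decides membership in the range. *)
exists (fun n => if alpha n == n then F (nseq n a) else nseq n a).
split=> [n | x].
  case: eqP => [an | _]; last by rewrite size_nseq.
  by rewrite (Falpha n) ?size_nseq.
have szFx : size (F x) = alpha (size x) by exact: Falpha.
have -> : alpha (alpha (size x)) = alpha (size x).
  by rewrite -(Falpha _ (F x)) // associative_str_idem.
(* Write [F x] as [F (F x)]; the inner [F x] has the same length as the [nseq] string. *)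
by rewrite eqxx -[LHS](associative_str_idem _ _ assoF); apply: lbF; rewrite size_nseq.
Qed.

Lemma factor_associative_length_based (X : Type) (F : seq X -> seq X)
    (psi : nat -> seq X) alpha :
  (forall n, size (psi n) = n) -> length_equation alpha ->
  (forall x, F x = psi (alpha (size x))) ->
  associative_str F /\ length_based F.
Proof.
move=> szpsi alphaE FE; split=> [x y z | x y szxy]; last by rewrite !FE szxy.
rewrite (FE (x ++ y ++ z)) (FE (x ++ F y ++ z)) !size_cat FE szpsi.
(* Only lengths remain, and addition commutes: with the middle summand moved to the front, the
   equation for [alpha] covers a nonempty prefix [x] too. *)
by rewrite addnCA alphaE [size x + (_ + _)]addnCA.
Qed.

Theorem proposition4p3 (X : Type) (hX : inhabited X) (F : seq X -> seq X) :
  (associative_str F -> weakly_length_based F ->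
     (exists alpha : nat -> nat, maps_lengths F alpha /\ length_equation alpha)
     /\
     (forall alpha : nat -> nat,
        maps_lengths F alpha -> length_equation alpha ->
        (standard F <-> (forall n : nat, alpha n = 0 <-> n = 0))))
  /\
  (associative_str F /\ length_based F <->
     exists (psi : nat -> seq X) (alpha : nat -> nat),
       (forall n : nat, size (psi n) = n) /\
       length_equation alpha /\
       (forall x : seq X, F x = psi (alpha (size x)))).
Proof.
case: hX => a; split=> [assoF wlbF | ].
  split=> [|alpha Falpha _]; last exact: (standardP _ a).
  have Falpha := maps_lengths_nseq _ a _ wlbF.
  by eexists; split; [exact: Falpha | exact: (maps_lengths_equation _ a _ _ assoF)].
split=> [[assoF lbF] | [psi [alpha [szpsi [alphaE FE]]]]].
  have Falpha := maps_lengths_nseq _ a _ (length_based_weakly _ _ lbF).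
  have [psi [szpsi FE]] := length_based_factor _ a _ _ assoF lbF Falpha.
  exists psi; eexists; split; first exact: szpsi.
  by split; [exact: (maps_lengths_equation _ a _ _ assoF Falpha) | exact: FE].
exact: factor_associative_length_based szpsi alphaE FE.
Qed.
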